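(* Let $G$ be a DAG on $X$, let $\mathcal{I}\subseteq\{1,\dots,|X|\}$ with $1\in\mathcal{I}$, suppose that $G$ has the $\mathcal{I}$-lca-property, and let $W$ be the set of all vertices of $G$ that are not $\mathcal{I}$-lca vertices in $G$. Then $$(G\ominus W)^-\simeq \mathscr{H}(\mathfrak{C}_G(\mathcal{I})).$$ In particular, $G\ominus W$ and $(G\ominus W)^-$ are $\mathcal{I}$-lca-relevant DAGs on $X$ that have the $\mathcal{I}$-lca-property and satisfy (S0)--(S4) with respect to $G$, and for which the set system $\mathfrak{C}_{G\ominus W}=\mathfrak{C}_{(G\ominus W)^-}=\mathfrak{C}_G(\mathcal{I})$ is $\mathcal{I}$-ary. In addition, $(G\ominus W)^-$ is regular. Moreover, $W$ is the unique, and therefore smallest, subset of $V(G)$ such that $G\ominus W$ as well as $(G\ominus W)^-$ are $\mathcal{I}$-lca-relevant and satisfy (S0)--(S4) with respect to $G$.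
   Context: All sets are finite. A directed graph $G=(V,E)$ has a nonempty vertex set $V(G)=V$ and edge set $E(G)=E\subseteq (V\times V)\setminus\{(v,v)\mid v\in V\}$. A DAG is a directed graph without directed cycles. Two directed graphs are isomorphic ($\simeq$) if there is a bijection between their vertex sets that preserves edges and non-edges (with direction). For a DAG $G$, write $v\preceq_G w$ if there is a directed path (possibly of length $0$) from $w$ to $v$; then $w$ is an ancestor of $v$; $v\prec_G w$ means $v\preceq_G w$ and $v\neq w$. $L(G)$ denotes the set of leaves ($\preceq_G$-minimal vertices, i.e. vertices with no outgoing edges); $G$ is a DAG on $X$ if $L(G)=X$. Clusters: $\mathtt{C}_G(v)=\{x\in L(G)\mid x\preceq_G v\}$ and $\mathfrak{C}_G=\{\mathtt{C}_G(v)\mid v\in V(G)\}$. LCAs: for $\emptyset\neq A\subseteq L(G)$, $\mathrm{LCA}_G(A)$ is the set of $\preceq_G$-minimal vertices among those that are ancestors of all elements of $A$. If $\mathrm{LCA}_G(A)=\{v\}$, write $\mathrm{lca}_G(A)=v$ and say $\mathrm{lca}_G(A)$ is well-defined; otherwise it is undefined. $X(\mathcal{I})$ is the set of all $A\subseteq X$ with $|A|\in\mathcal{I}$. A vertex $v$ of a DAG $G$ on $X$ is an $\mathcal{I}$-lca vertex if $v=\mathrm{lca}_G(A)$ for some $A\in X(\mathcal{I})$. $G$ is $\mathcal{I}$-lca-relevant if all its vertices are $\mathcal{I}$-lca vertices. $G$ has the $\mathcal{I}$-lca-property if $\mathrm{lca}_G(A)$ is well-defined for all $A\in X(\mathcal{I})$.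 Set systems: a set system on $X$ is a collection of subsets of $X$. An element $C$ of a set system $\mathfrak{C}$ on $X$ satisfies ($\mathcal{I}$-$C$) if there is some $A\in X(\mathcal{I})$ such that $C$ is the unique inclusion-minimal element of $\mathfrak{C}$ with $A\subseteq C$. $\mathfrak{C}(\mathcal{I})=\{C\in\mathfrak{C}\mid C\text{ satisfies }(\mathcal{I}\text{-}C)\}$ (with the condition evaluated in $\mathfrak{C}$). $\mathfrak{C}$ is pre-$\mathcal{I}$-ary if for all $A\in X(\mathcal{I})$ there is a unique inclusion-minimal $C\in\mathfrak{C}$ with $A\subseteq C$; it is $\mathcal{I}$-ary if it is pre-$\mathcal{I}$-ary and every $C\in\mathfrak{C}$ satisfies ($\mathcal{I}$-$C$). The Hasse diagram $\mathscr{H}(\mathfrak{C})$ is the DAG with vertex set $\mathfrak{C}$ and an edge from $A$ to $B$ iff $B\subsetneq A$ and there is no $C\in\mathfrak{C}$ with $B\subsetneq C\subsetneq A$. A DAG $G$ is regular if the map $v\mapsto\mathtt{C}_G(v)$ is an isomorphism from $G$ to $\mathscr{H}(\mathfrak{C}_G)$. An edge $(u,w)$ of a DAG $G$ is a shortcut if there is a vertex $v$ with $w\prec_G v\prec_G u$. $G^-$ is the directed graph obtained from $G$ by removing all shortcuts from its edge set. The operator $\ominus$: for $v\in V(G)$, $G\ominus v$ is the directed graph with vertex set $V(G)\setminus\{v\}$ in which $(p,q)$ is an edge precisely if ($p\neq v$, $q\neq v$ and $(p,q)\in E(G)$) or ($(p,v)\in E(G)$ and $(v,q)\in E(G)$).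 For nonempty $W=\{w_1,\dots,w_\ell\}\subsetneq V(G)$, $G\ominus W=(\dots((G\ominus w_1)\ominus w_2)\dots)\ominus w_\ell$; and $G\ominus\emptyset=G$. A directed graph $H$ satisfies (S0)--(S4) with respect to a DAG $G$ on $X$ if: (S0) $\mathfrak{C}_H\subseteq\mathfrak{C}_G$ and, in particular, $\mathtt{C}_G(u)=\mathtt{C}_H(u)$ for all $u\in V(H)$; (S1) $H$ is a DAG on $X$; (S2) $V(H)\subseteq V(G)$; (S3) for all $u,w\in V(H)$, $u\prec_G w$ if and only if $u\prec_H w$; (S4) $\mathrm{lca}_H(A)=\mathrm{lca}_G(A)$ for all $A\in X(\mathcal{I})$ for which $\mathrm{lca}_G(A)$ is well-defined. *)

(* Defs.v *)
From mathcomp Require Import all_boot.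

Set Implicit Arguments.
Unset Strict Implicit.
Unset Printing Implicit Defensive.

(* A graph lives in an ambient finite type [U]; its vertex set is a subset of
   [U], so that a graph obtained by deleting vertices has the same type.  The
   record holds only the data: see [is_digraph] for the well-formedness
   conditions. *)
Record digraph (U : finType) := Digraph {
  vertices : {set U};
  edges : {set U * U}
}.

Section Graphs.
Variable U : finType.
Implicit Types (G H : digraph U) (u v w x : U) (A X : {set U}) (I : {pred nat}).

Definition edge G : rel U := fun u v => (u, v) \in edges G.

Definition is_digraph G : Prop :=
  vertices G != set0 /\
  forall u v, edge G u v ->
    [/\ u \in vertices G, v \in vertices G & u != v].

Definition is_dag G : Prop :=
  is_digraph G /\ forall c : seq U, ucycle (edge G) c -> c = [::].

(* [gle G v w]: there is a directed path from [w] to [v]. The membership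
   conditions are needed because [connect] is reflexive on all of [U]. *)
Definition gle G v w : bool :=
  [&& v \in vertices G, w \in vertices G & connect (edge G) w v].

Definition glt G v w : bool := gle G v w && (v != w).

Definition leaves G : {set U} :=
  [set v in vertices G | ~~ [exists w, glt G w v]].

Definition dag_on X G : Prop := is_dag G /\ leaves G = X.

Definition cluster G v : {set U} := [set x in leaves G | gle G x v].

Definition clusters G : {set {set U}} :=
  [set cluster G v | v in vertices G].

Definition common_ancestors G A : {set U} :=
  [set v in vertices G | [forall x in A, gle G x v]].

(* Meaningful for nonempty [A \subset leaves G] only. *)
Definition LCA G A : {set U} :=
  [set v in common_ancestors G A |
    ~~ [exists w in common_ancestors G A, glt G w v]].

(* [lca G A = Some v] iff [LCA G A = [set v]]; [None] means undefined. *)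
Definition lca G A : option U := unset1 (LCA G A).

Definition sized_subsets I X : {set {set U}} :=
  [set A : {set U} | (A \subset X) && (#|A| \in I)].

Definition is_lca_vertex I G v : bool :=
  [exists A in sized_subsets I (leaves G), lca G A == Some v].

Definition lca_relevant I G : Prop :=
  forall v, v \in vertices G -> is_lca_vertex I G v.

Definition lca_property I G : Prop :=
  forall A, A \in sized_subsets I (leaves G) -> exists v, lca G A = Some v.

Definition shortcut G u w : bool :=
  edge G u w && [exists v, glt G w v && glt G v u].

Definition remove_shortcuts G : digraph U :=
  Digraph (vertices G) [set e in edges G | ~~ shortcut G e.1 e.2].

Definition ominus G v : digraph U :=
  Digraph (vertices G :\ v)
    [set e in setX (vertices G :\ v) (vertices G :\ v)
      | edge G e.1 e.2 || edge G e.1 v && edge G v e.2].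

(* The vertices are removed in the order of [enum W]; by [ominus_seq_perm]
   below, any other order gives the same graph. *)
Definition ominus_set G (W : {set U}) : digraph U := foldl ominus G (enum W).

(* The conditions (S0)-(S4) on [H] with respect to a DAG [G] on [X]. *)
Definition S0 G H : Prop :=
  clusters H \subset clusters G /\
  forall u, u \in vertices H -> cluster G u = cluster H u.
Definition S1 X H : Prop := dag_on X H.
Definition S2 G H : Prop := vertices H \subset vertices G.
Definition S3 G H : Prop :=
  forall u w, u \in vertices H -> w \in vertices H -> glt G u w = glt H u w.
Definition S4 I X G H : Prop :=
  forall A, A \in sized_subsets I X ->
  forall v, lca G A = Some v -> lca H A = Some v.

Definition S0_to_S4 I X G H : Prop :=
  [/\ S0 G H, S1 X H, S2 G H, S3 G H & S4 I X G H].

Lemma ominusC G u v : u \in vertices G -> v \in vertices G ->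
  ominus (ominus G u) v = ominus (ominus G v) u.
Proof.
move=> uV vV; have [->//|nuv] := eqVneq u v.
rewrite {1 3}/ominus; congr Digraph.
  by apply/setP=> x; rewrite !inE; do 2![case: (x == _)].
apply/setP=> -[p q]; rewrite !inE /edge /= !inE /= uV vV.
rewrite nuv (eq_sym v u) nuv /=.
case: (p \in _); rewrite ?andbF //.
case: (q \in _); rewrite ?andbF //.
case: (p == u); case: (p == v); case: (q == u); case: (q == v) => //=.
rewrite -!/(edge G _ _).
by case: (edge G p q); case: (edge G p u); case: (edge G p v);
  case: (edge G u q); case: (edge G v q); case: (edge G u v);
  case: (edge G v u).
Qed.

Lemma ominus_seq_perm G (s t : seq U) :
  uniq s -> {subset s <= vertices G} -> perm_eq s t ->
  foldl ominus G s = foldl ominus G t.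
Proof.
have pull (r : seq U) x H : uniq r -> {subset r <= vertices H} -> x \in r ->
    foldl ominus H r = foldl ominus (ominus H x) (rem x r).
  elim: r H => //= y r IH H /andP[yr ur] sH; rewrite inE eq_sym.
  case: eqVneq => [->//|nyx] /= xr; rewrite IH //; last first.
    move=> z zr; rewrite !inE sH ?inE ?zr ?orbT // andbT.
    by apply: contraNneq yr => <-.
  by rewrite ominusC // sH ?inE ?eqxx ?xr ?orbT.
elim: t s G => [|x t IH] s G us sG st; first by rewrite (perm_nilP st).
have xs : x \in s by rewrite (perm_mem st) inE eqxx.
rewrite (pull s x) //=; apply: IH; first exact: rem_uniq.
  move=> z; rewrite mem_rem_uniq // !inE => /andP[-> zs] /=; exact: sG.
by rewrite -(perm_cons x) -(permPl (perm_to_rem xs)).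
Qed.

End Graphs.

Section Isomorphisms.
Variables U U' : finType.

Definition is_isomorphism (G : digraph U) (H : digraph U') (f : U -> U') : Prop :=
  [/\ {in vertices G &, injective f},
      f @: vertices G = vertices H &
      {in vertices G &, forall u v, edge G u v = edge H (f u) (f v)}].

Definition isomorphic (G : digraph U) (H : digraph U') : Prop :=
  exists f : U -> U', is_isomorphism G H f.

End Isomorphisms.

Section SetSystems.
Variable U : finType.
Implicit Types (F : {set {set U}}) (A C X : {set U}) (I : {pred nat}).

Definition minimal_containing F A : {set {set U}} :=
  [set C | minset (fun D : {set U} => (D \in F) && (A \subset D)) C].

(* The condition (I-C) for [C] in a set system [F] on [X]. *)
Definition satisfies_IC X I F C : bool :=
  [exists A in sized_subsets I X, minimal_containing F A == [set C]].

Definition IC_part X I F : {set {set U}} :=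
  [set C in F | satisfies_IC X I F C].

Definition pre_ary X I F : Prop :=
  forall A, A \in sized_subsets I X -> exists C, minimal_containing F A = [set C].

Definition ary X I F : Prop :=
  pre_ary X I F /\ forall C, C \in F -> satisfies_IC X I F C.

Definition hasse F : digraph {set U} :=
  Digraph F
    [set e in setX F F | (e.2 \proper e.1) &&
      ~~ [exists C in F, (e.2 \proper C) && (C \proper e.1)]].

Definition regular (G : digraph U) : Prop :=
  is_isomorphism G (hasse (clusters G)) (cluster G).

End SetSystems.

(* Main.v *)
Require Import Defs.
From mathcomp Require Import all_boot.

(** Deleting vertices with [ominus] and deleting shortcuts both keep the
    ancestor order on the remaining vertices, so [GW] and [GWm] carry the order
    of [G] restricted to the I-lca vertices.  In a finite DAG, [lca A] is the
    least common ancestor of [A] in that order, hence it is inherited by every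
    restriction containing it, and its cluster is the least cluster containing
    [A].  Consequently [v |-> cluster v] is an order embedding on I-lca vertices
    with image [IC_part X I (clusters G)]; in a DAG without shortcuts the edges
    are the covering pairs, which turns this embedding into an isomorphism onto
    the Hasse diagram.  Uniqueness of [W] only needs (S4) and relevance. *)

Set Implicit Arguments.
Unset Strict Implicit.
Unset Printing Implicit Defensive.

Section Dags.
Variable U : finType.
Implicit Types (G H : digraph U) (u v w x y z : U) (A X W : {set U}).
Implicit Types (I : {pred nat}).

(** Closing an edge with a returning path gives a cycle. The edgewise form on the right is easier to
    carry through vertex deletions than a statement about cycles. *)
Lemma acyclicP G :
  (forall c : seq U, ucycle (edge G) c -> c = [::]) <->
  (forall u v, edge G u v -> ~~ connect (edge G) v u).
Proof.
split=> [acG u v uv | acG [//|x p] /andP[cyc _]].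
  apply/negP=> /connectP[p vp lastp].
  (* [ucycle] demands distinct vertices, so the returning path is first made duplicate-free. *)
  case/shortenP: vp lastp => q vq uq _ lastq.
  have /acG : ucycle (edge G) (v :: q) by rewrite /ucycle /= rcons_path vq -lastq uv.
  by [].
move: cyc; rewrite /= rcons_path => /andP[xp /acG/negP[]].
by apply/connectP; exists p.
Qed.

Lemma edge_in G u v : is_digraph G -> edge G u v ->
  [/\ u \in vertices G, v \in vertices G & u != v].
Proof. by case=> _; apply. Qed.

(** * Ancestor order, least common ancestors and clusters of one DAG *)

Section Order.
Variable G : digraph U.
Hypothesis dagG : is_dag G.

Lemma dag_digraph : is_digraph G. Proof. by case: dagG. Qed.

Lemma gle_refl v : v \in vertices G -> gle G v v.
Proof. by move=> vG; rewrite /gle vG connect0. Qed.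

Lemma gle_trans v u w : gle G u v -> gle G v w -> gle G u w.
Proof.
case/and3P=> uG _ vu /and3P[_ wG wv].
by rewrite /gle uG wG (connect_trans wv vu).
Qed.

Lemma gle_anti u v : gle G u v -> gle G v u -> u = v.
Proof.
case/and3P=> _ _ vu /and3P[_ _ /connectP[[|z p] /=]]; first by move=> _ ->.
case/andP=> uz zp def_v; case: dagG => _ /acyclicP/(_ _ _ uz)/negP[].
by apply: connect_trans vu; rewrite def_v; apply/connectP; exists p.
Qed.

Lemma edge_glt u v : edge G u v -> glt G v u.
Proof.
move=> uv; have [uG vG nuv] := edge_in dag_digraph uv.
by rewrite /glt /gle uG vG eq_sym nuv connect1.
Qed.

Lemma glt_edge u w : glt G w u -> exists2 z, edge G u z & gle G w z.
Proof.
case/andP=> /and3P[wG uG /connectP[[|z p] /=]]; first by move=> _ ->; rewrite eqxx.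
case/andP=> uz zp -> _; exists z => //; rewrite /gle.
have [_ zG _] := edge_in dag_digraph uz.
have zw: connect (edge G) z (last z p) by apply/connectP; exists p.
rewrite zG zw !andbT.
by elim/last_ind: p zp {zw} => // p y _; rewrite rcons_path last_rcons
  => /andP[_ /(edge_in dag_digraph)[]].
Qed.

(** Among the vertices below [w] satisfying [P], take one with the fewest descendants: a strictly
    smaller candidate would have a strictly smaller down-set, since [v] itself drops out. *)
Lemma exists_minimal (P : pred U) w : w \in vertices G -> P w ->
  exists v, [/\ P v, gle G v w & forall z, P z -> ~~ glt G z v].
Proof.
move=> wG Pw; have P0 : P w && gle G w w by rewrite Pw gle_refl.
case: (@arg_minnP _ w [pred v | P v && gle G v w]
  (fun v => #|[set z | gle G z v]|) P0) => v /andP[Pv vw] min_v.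
exists v; split=> // z Pz; apply/negP=> /andP[zv nzv].
have := min_v z; rewrite inE Pz (gle_trans zv vw) => /(_ isT).
rewrite leqNgt => /negP[]; apply: proper_card; apply/properP; split.
  by apply/subsetP=> t; rewrite !inE => /gle_trans; apply.
have [_ vG _] := and3P zv.
exists v; rewrite !inE ?gle_refl //.
by apply: contra nzv => vz; rewrite (gle_anti zv vz).
Qed.

Lemma leaf_below w : w \in vertices G -> exists2 x, x \in leaves G & gle G x w.
Proof.
move=> wG; have [v [_ vw min_v]] := exists_minimal (P := predT) wG isT.
exists v => //; rewrite inE; have [-> _ _] := and3P vw.
by apply/existsPn=> z; apply: min_v.
Qed.

(** By finiteness every common ancestor has a minimal one below it; if [v] is the only minimal one,
    it is therefore least. This order-theoretic form is what transfers between graphs. *)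
Lemma lcaP A v :
  lca G A = Some v <->
  v \in common_ancestors G A /\
    (forall w, w \in common_ancestors G A -> gle G v w).
Proof.
have lca_set1 : lca G A = Some v <-> LCA G A = [set v].
  split=> [lcaA|eA]; last by rewrite /lca eA set1K.
  by move: (unset1K (LCA G A)); rewrite -/(lca G A) lcaA.
split=> [/lca_set1 eA | [vA min_v]].
  have : v \in LCA G A by rewrite eA set11.
  rewrite inE => /andP[vA _]; split=> // w wA.
  have wG : w \in vertices G by move: wA; rewrite inE => /andP[].
  have [z [zA zw min_z]] := exists_minimal (P := mem (common_ancestors G A)) wG wA.
  suff /set1P <- : z \in [set v] by [].
  rewrite -eA; apply/setIdP; split=> //; apply/existsPn=> t; rewrite negb_and.
  by case: (boolP (t \in common_ancestors G A)) => //= tA; apply: min_z.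
apply/lca_set1/setP=> w; apply/setIdP/set1P=> [[wA /existsPn/(_ v)] | ->].
  by rewrite vA /glt min_v //= negbK => /eqP.
split=> //; apply/existsPn=> t; apply/negP=> /andP[/min_v vt /andP[tv]].
by rewrite (gle_anti tv vt) eqxx.
Qed.

Lemma lca_leaf x : x \in leaves G -> lca G [set x] = Some x.
Proof.
case/setIdP=> xG _; apply/lcaP; split; first apply/setIdP; first split=> //.
  by apply/forall_inP=> y /set1P->; apply: gle_refl.
by move=> w; rewrite inE => /andP[_ /forall_inP]; apply; rewrite set11.
Qed.

(** This is why [1 \in I] matters: no leaf is deleted, so the leaf set stays the same. *)
Lemma leaf_is_lca_vertex I x : 1 \in I -> x \in leaves G -> is_lca_vertex I G x.
Proof.
move=> I1 xL; apply/existsP; exists [set x].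
by rewrite lca_leaf // eqxx andbT; apply/setIdP; rewrite sub1set cards1.
Qed.

Lemma subset_cluster A v : A \subset leaves G -> v \in vertices G ->
  (A \subset cluster G v) = (v \in common_ancestors G A).
Proof.
move=> /subsetP AL vG; rewrite inE vG; apply/subsetP/forall_inP => sA x xA.
  by move: (sA x xA); rewrite inE => /andP[].
by rewrite inE AL ?sA.
Qed.

Lemma gle_cluster v w : gle G v w -> cluster G v \subset cluster G w.
Proof.
move=> vw; apply/subsetP=> x; rewrite !inE => /andP[-> xv].
exact: gle_trans xv vw.
Qed.

Lemma lca_vertices A v : lca G A = Some v -> v \in vertices G.
Proof. by move/lcaP=> []; rewrite inE => /andP[]. Qed.

Lemma lca_minimal_containing A v : A \subset leaves G -> lca G A = Some v ->
  minimal_containing (clusters G) A = [set cluster G v].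
Proof.
move=> AL lcaA; have vG := lca_vertices lcaA; have [vA min_v] := (lcaP _ _).1 lcaA.
have Av : A \subset cluster G v by rewrite subset_cluster.
apply/setP=> C; rewrite !inE; apply/minsetP/eqP=> [[/andP[/imsetP[w wG ->] Aw] minC]|->].
  apply/esym/minC; first by rewrite imset_f ?Av.
  by apply/gle_cluster/min_v; rewrite -subset_cluster.
split; first by rewrite imset_f ?Av.
move=> D /andP[/imsetP[w wG ->] Aw] sD; apply/eqP; rewrite eqEsubset sD.
by apply/gle_cluster/min_v; rewrite -subset_cluster.
Qed.

(** If [v] is the lca of [A] and its cluster lies in that of [w], then [w] is also a common ancestor
    of [A], hence above [v]. *)
Lemma lca_vertex_cluster_subset I v w : is_lca_vertex I G v -> w \in vertices G ->
  (cluster G v \subset cluster G w) = gle G v w.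
Proof.
case/existsP=> A /andP[/setIdP[AL _] /eqP/[dup] lcaA /lcaP[vA min_v]] wG.
apply/idP/idP=> [sub_vw|]; last exact: gle_cluster.
apply: min_v; rewrite -subset_cluster //; apply: subset_trans sub_vw.
by rewrite subset_cluster // (lca_vertices lcaA).
Qed.

(** A witness [A] for (I-C) has an lca by the lca-property, and the cluster of that lca is the only
    minimal cluster containing [A]. Conversely, a set with lca [v] is a witness for the cluster of
    [v]. *)
Lemma IC_part_lca I : lca_property I G ->
  IC_part (leaves G) I (clusters G) =
    [set cluster G v | v in vertices G & is_lca_vertex I G v].
Proof.
move=> lcaG; apply/setP=> C; apply/setIdP/imsetP=> [[_ /existsP]|].
  case=> A /andP[AI /eqP minA]; have [v lcaA] := lcaG A AI.
  exists v; last first.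
    apply/set1P; rewrite -(lca_minimal_containing (A := A)) ?minA ?set11 //.
    by case/setIdP: AI.
  rewrite inE (lca_vertices lcaA); apply/existsP; exists A.
  by rewrite AI lcaA eqxx.
case=> v /setIdP[vG /existsP[A /andP[AI /eqP lcaA]]] ->; rewrite imset_f //.
split=> //; apply/existsP; exists A; rewrite AI.
by rewrite (lca_minimal_containing _ lcaA) ?eqxx //; case/setIdP: AI.
Qed.

Lemma ary_clusters I : lca_property I G -> lca_relevant I G ->
  ary (leaves G) I (clusters G).
Proof.
move=> lcaG relG; split=> [A AI | C CG].
  have [v lcaA] := lcaG A AI; exists (cluster G v).
  by apply: lca_minimal_containing => //; case/setIdP: AI.
suff : C \in IC_part (leaves G) I (clusters G) by case/setIdP.
rewrite IC_part_lca //; case/imsetP: CG => v vG ->.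
by rewrite imset_f // inE vG relG.
Qed.

(** Relevance makes [cluster G] an order embedding; without shortcuts, the edges are exactly the
    covering pairs of the order, as in a Hasse diagram. *)
Lemma regular_of_relevant I : lca_relevant I G ->
  (forall u w, ~~ shortcut G u w) -> regular G.
Proof.
move=> relG no_sc.
have subE : {in vertices G &, forall v w, (cluster G v \subset cluster G w) = gle G v w}.
  by move=> v w vG wG; apply: (@lca_vertex_cluster_subset I) => //; apply: relG.
have cluster_proper :
    {in vertices G &, forall v w, (cluster G v \proper cluster G w) = glt G v w}.
  move=> v w vG wG; rewrite properE !subE // /glt.
  case: (boolP (gle G v w)) => //= vw; congr (~~ _).
  by apply/idP/eqP=> [/(gle_anti vw) //|->]; apply: gle_refl.
split=> [v w vG wG e | // | u w uG wG].
  by apply: gle_anti; rewrite -subE // e.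
rewrite /edge inE !inE /= !imset_f //= cluster_proper // -/(edge G u w).
apply/idP/andP=> [uw | [wu /existsPn no_mid]].
  split; first exact: edge_glt.
  apply/existsPn=> C; apply/negP=> /andP[/imsetP[v vG ->]]; rewrite !cluster_proper // => mid.
  by have /negP[] := no_sc u w; rewrite /shortcut uw; apply/existsP; exists v.
(* Take the first edge of a path from [u] to [w]: unless it already ends at [w], its endpoint gives
   a cluster strictly between the two. *)
have [z uz wz] := glt_edge wu; have [_ zG _] := edge_in dag_digraph uz.
have [-> // | nwz] := eqVneq w z.
have /negP[] := no_mid (cluster G z).
by rewrite imset_f //= !cluster_proper // (edge_glt uz) /glt wz nwz.
Qed.

End Order.

(** * Graphs carrying the restricted ancestor order of a DAG *)

Section InducedOrder.
Variables (G H : digraph U).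

(** Only the orders are compared, not the edges, so that the results apply both before and after
    shortcut removal. *)
Definition induced_order :=
  vertices H \subset vertices G /\ {in vertices H &, gle H =2 gle G}.

Hypotheses (dagG : is_dag G) (dagH : is_dag H) (ordH : induced_order).
Hypothesis (leafH : leaves G \subset vertices H).

(** Below any vertex of [H] lies a leaf of [G], which survives in [H]; a minimal vertex of [H] must
    coincide with it. *)
Lemma induced_leaves : leaves H = leaves G.
Proof.
have [/subsetP sHG gleE] := ordH; have /subsetP lH := leafH.
apply/setP=> v; apply/idP/idP=> [/setIdP[vH /existsPn min_v] | vL].
  have [x xL xv] := leaf_below dagG (sHG v vH).
  have := min_v x; rewrite /glt gleE ?(lH x) // xv negbK => /eqP <-.
  exact: xL.
rewrite inE lH //; apply/existsPn=> w; apply/negP=> /andP[].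
move=> /[dup] /and3P[wH _ _]; rewrite gleE ?(lH v) // => wv nwv.
by case/setIdP: vL => _ /existsPn/(_ w); rewrite /glt wv nwv.
Qed.

Lemma induced_cluster v : v \in vertices H -> cluster H v = cluster G v.
Proof.
move=> vH; apply/setP=> x; rewrite inE [RHS]inE induced_leaves.
case: (boolP (x \in leaves G)) => //= xL.
by case: ordH => _ -> //; apply: (subsetP leafH).
Qed.

Lemma induced_common_ancestors A : A \subset leaves G ->
  common_ancestors H A = common_ancestors G A :&: vertices H.
Proof.
have [/subsetP sHG gleE] := ordH; move=> /subsetP AL.
apply/setP=> v; rewrite !inE andbC; case: (boolP (v \in vertices H)) => vH;
  rewrite ?andbF ?andbT //= sHG //=.
by apply: eq_forallb_in => x xA; rewrite gleE //; apply/(subsetP leafH)/AL.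
Qed.

(** A least element of the common ancestors stays least in any restriction that still contains
    it. *)
Lemma induced_lca A v : A \subset leaves G -> v \in vertices H ->
  lca G A = Some v -> lca H A = Some v.
Proof.
move=> AL vH /lcaP[//|vA min_v]; apply/lcaP => //.
rewrite induced_common_ancestors // inE vA vH; split=> // w /setIP[wA wH].
by case: ordH => _ ->; rewrite ?min_v.
Qed.

(** * The case where exactly the I-lca vertices are kept *)

Variable I : {pred nat}.
Hypothesis lcaG : lca_property I G.
Hypothesis verticesH : vertices H = [set v in vertices G | is_lca_vertex I G v].

Lemma relevant_lca A v : A \in sized_subsets I (leaves G) ->
  lca G A = Some v -> lca H A = Some v.
Proof.
move=> AI lcaA; apply: induced_lca => //; first by case/setIdP: AI.
rewrite verticesH inE (lca_vertices dagG lcaA); apply/existsP; exists A.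
by rewrite AI lcaA eqxx.
Qed.

Lemma relevant_lca_property : lca_property I H.
Proof.
move=> A; rewrite induced_leaves => AI; have [v lcaA] := lcaG AI.
by exists v; apply: relevant_lca.
Qed.

Lemma relevant_lca_relevant : lca_relevant I H.
Proof.
move=> v; rewrite verticesH => /setIdP[vG /existsP[A /andP[AI /eqP lcaA]]].
by apply/existsP; exists A; rewrite induced_leaves AI (relevant_lca AI lcaA) eqxx.
Qed.

Lemma relevant_S0_to_S4 : S0_to_S4 I (leaves G) G H.
Proof.
have [sHG gleE] := ordH; split=> //.
- split=> [|v vH]; last by rewrite induced_cluster.
  apply/subsetP=> C /imsetP[v vH ->].
  by rewrite induced_cluster // imset_f // (subsetP sHG).
- by split=> //; apply: induced_leaves.
- by move=> u w uH wH; rewrite /glt gleE.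
- by move=> A AI v; apply: relevant_lca.
Qed.

Lemma relevant_clusters : clusters H = IC_part (leaves G) I (clusters G).
Proof.
rewrite IC_part_lca // -verticesH; apply: eq_in_imset => v; exact: induced_cluster.
Qed.

End InducedOrder.

(** * Vertex deletion preserves the order *)

Section Ominus.
Variables (G : digraph U) (v : U).
Hypothesis wfG : forall u w, edge G u w ->
  [/\ u \in vertices G, w \in vertices G & u != w].
Hypothesis acG : forall u w, edge G u w -> ~~ connect (edge G) w u.

Lemma ominus_edge p q : edge (ominus G v) p q =
  [&& p != v, q != v & edge G p q || edge G p v && edge G v q].
Proof.
rewrite {1}/edge /ominus !inE /=; case: (p == v); case: (q == v); rewrite ?andbF //=.
case: (boolP (_ || _)) => [/orP[|/andP[]]|]; rewrite ?andbF ?andbT //.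
  by case/wfG=> -> ->.
by case/wfG=> -> _ _ /wfG[_ ->].
Qed.

Lemma ominus_edge_connect p q : edge (ominus G v) p q -> connect (edge G) p q.
Proof.
rewrite ominus_edge => /and3P[_ _ /orP[/connect1 // | /andP[pv vq]]].
exact: connect_trans (connect1 pv) (connect1 vq).
Qed.

(** Each passage of a path through [v] is replaced by the bypass edge from the predecessor of [v] to
    its successor. *)
Lemma ominus_connect u w : u != v -> w != v ->
  connect (edge (ominus G v)) u w = connect (edge G) u w.
Proof.
move=> nuv nwv; apply/idP/idP.
  by apply: connect_sub => p q; apply: ominus_edge_connect.
case/connectP=> p up def_w; subst w.
(* For a path starting at the deleted vertex, start from a predecessor of it. *)
suff : (u != v -> connect (edge (ominus G v)) u (last u p)) /\
       (u = v -> forall t, edge G t v -> connect (edge (ominus G v)) t (last u p)).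
  by case=> /(_ nuv).
elim: p u {nuv} up nwv => [|z p IH] u /=; first by move=> _ nuv; split=> // e; rewrite e eqxx in nuv.
case/andP=> uz zp nlast; have [IH1 IH2] := IH z zp nlast.
split=> [nuv | e t tv].
  have [ezv|nzv] := eqVneq z v; first by apply: IH2; rewrite -?ezv.
  by apply: connect_trans (IH1 nzv); apply: connect1; rewrite ominus_edge nuv nzv uz.
rewrite e in uz; have [_ _ nvz] := wfG uz; have [_ _ ntv] := wfG tv.
have nzv : z != v by rewrite eq_sym.
apply: connect_trans (IH1 nzv); apply: connect1.
by rewrite ominus_edge ntv nzv tv uz orbT.
Qed.

Lemma ominus_wf u w : edge (ominus G v) u w ->
  [/\ u \in vertices (ominus G v), w \in vertices (ominus G v) & u != w].
Proof.
rewrite ominus_edge !inE => /and3P[-> -> /orP[/wfG[-> -> ->] // | /andP[uv vw]]].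
have [-> _ _] := wfG uv; have [_ -> _] := wfG vw; split=> //.
(* A bypass edge that is a loop would come from a 2-cycle through [v]. *)
by apply/eqP=> e; move: vw; rewrite -e => /acG; rewrite connect1.
Qed.

Lemma ominus_acyclic u w :
  edge (ominus G v) u w -> ~~ connect (edge (ominus G v)) w u.
Proof.
move=> uw; move: (uw); rewrite ominus_edge => /and3P[nuv nwv uvw].
rewrite ominus_connect //; case/orP: uvw => [/acG // | /andP[uv vw]].
by apply/negP=> wu; case/negP: (acG uv); apply: connect_trans (connect1 vw) wu.
Qed.

End Ominus.

(** The invariant is [is_dag] without nonemptiness, since [s] may exhaust the vertices; nonemptiness
    is restored in [ominus_set_dag]. *)
Lemma foldl_ominus_order (s : seq U) G :
  (forall u w, edge G u w -> [/\ u \in vertices G, w \in vertices G & u != w]) ->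
  (forall u w, edge G u w -> ~~ connect (edge G) w u) ->
  let H := foldl (@ominus U) G s in
  [/\ forall u w, edge H u w -> [/\ u \in vertices H, w \in vertices H & u != w],
      forall u w, edge H u w -> ~~ connect (edge H) w u,
      vertices H = [set u in vertices G | u \notin s] &
      {in vertices H &, gle H =2 gle G}].
Proof.
elim: s G => [|v s IH] G wfG acG /=.
  by split=> //; apply/setP=> u; rewrite !inE andbT.
have [wfH acH eqH gleH] := IH (ominus G v) (ominus_wf wfG acG) (ominus_acyclic wfG acG).
split=> //.
  by rewrite eqH; apply/setP=> u; rewrite !inE negb_or; case: (u == v); rewrite ?andbF ?andbT.
move=> u w uH wH; rewrite gleH //; move: uH wH; rewrite eqH !inE.
case/andP=> /andP[nuv uG] _ /andP[/andP[nwv wG] _].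
by rewrite /gle !inE nuv nwv uG wG ominus_connect.
Qed.

Lemma ominus_set_vertices G W : is_dag G ->
  vertices (ominus_set G W) = vertices G :\: W.
Proof.
case=> -[_ wfG] /acyclicP acG; have [_ _ -> _] := foldl_ominus_order (enum W) wfG acG.
by apply/setP=> u; rewrite !inE mem_enum andbC.
Qed.

Lemma ominus_set_dag G W : is_dag G -> vertices G :\: W != set0 ->
  is_dag (ominus_set G W).
Proof.
move=> dagG; rewrite -ominus_set_vertices // => ne; case: dagG => -[_ wfG] /acyclicP acG.
have [wfH acH _ _] := foldl_ominus_order (enum W) wfG acG.
by split; [split | apply/acyclicP].
Qed.

Lemma ominus_set_induced G W : is_dag G -> induced_order G (ominus_set G W).
Proof.
move=> dagG; split; first by rewrite ominus_set_vertices ?subsetDl.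
by case: dagG => -[_ wfG] /acyclicP acG; have [] := foldl_ominus_order (enum W) wfG acG.
Qed.

(** * Shortcut removal preserves the order *)

Section RemoveShortcuts.
Variable G : digraph U.
Hypothesis dagG : is_dag G.

Lemma remove_shortcuts_edge u w :
  edge (remove_shortcuts G) u w = edge G u w && ~~ shortcut G u w.
Proof. by rewrite /edge inE. Qed.

(** Induction on the size of the interval between [w] and [u]: a vertex strictly inside splits it
    into two smaller intervals, and an interval with empty interior is spanned by an edge that is no
    shortcut. *)
Lemma remove_shortcuts_gle : gle (remove_shortcuts G) =2 gle G.
Proof.
move=> w u; apply/idP/idP.
  case/and3P=> wG uG uw; rewrite /gle wG uG; apply: connect_sub uw => p q.
  by rewrite remove_shortcuts_edge => /andP[/connect1].
have [n] := ubnP #|[set z | gle G w z & gle G z u]|.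
elim: n u w => // n IH u w; rewrite ltnS => le_n wu; have [wG uG _] := and3P wu.
have [-> | nwu] := eqVneq w u; first by rewrite /gle /= uG connect0.
have glt_wu : glt G w u by rewrite /glt wu.
have [/existsP[v /andP[/andP[wv nwv] /andP[vu nvu]]] | no_mid] :=
  boolP [exists v, glt G w v && glt G v u].
  have [_ vG _] := and3P wv.
  apply: (@gle_trans _ v); apply: IH => //; apply: leq_trans le_n;
    apply: proper_card; apply/properP; split.
  - by apply/subsetP=> z; rewrite !inE => /andP[-> /gle_trans]; apply.
  - exists u; rewrite !inE ?wu ?gle_refl //.
    by apply/negP=> uv; rewrite (gle_anti dagG uv vu) eqxx in nvu.
  - by apply/subsetP=> z; rewrite !inE => /andP[/(gle_trans wv)-> ->].
  - exists w; rewrite !inE ?wu ?gle_refl //=.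
    by apply/negP=> /andP[vw _]; rewrite (gle_anti dagG vw wv) eqxx in nwv.
(* Nothing lies strictly between, so the first edge of a path from [u] to [w] must end at [w]. *)
have [z uz wz] := glt_edge dagG glt_wu.
have [e | nwz] := eqVneq w z; last first.
  case/existsP: no_mid; exists z.
  by rewrite (edge_glt dagG uz) /glt wz nwz.
rewrite /gle wG uG connect1 // remove_shortcuts_edge e uz.
by rewrite /shortcut uz -e.
Qed.

Lemma remove_shortcuts_dag : is_dag (remove_shortcuts G).
Proof.
case: (dagG) => -[ne wfG] /acyclicP acG; split.
  by split=> // u v; rewrite remove_shortcuts_edge => /andP[/wfG].
apply/acyclicP=> u v; rewrite remove_shortcuts_edge => /andP[uv _].
have [uG vG _] := wfG _ _ uv; apply: contra (acG _ _ uv) => vu.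
suff : gle G u v by case/and3P.
by rewrite -remove_shortcuts_gle /gle uG vG.
Qed.

(** Being a shortcut depends on the edge and on the order; the order is unchanged, so one round of
    removal creates no new shortcut. *)
Lemma remove_shortcuts_no_shortcut u w : ~~ shortcut (remove_shortcuts G) u w.
Proof.
apply/negP=> /andP[]; rewrite remove_shortcuts_edge => /andP[uw /negP no_mid].
case/existsP=> v; rewrite /glt !remove_shortcuts_gle => mid; apply: no_mid.
by rewrite /shortcut uw; apply/existsP; exists v.
Qed.

End RemoveShortcuts.

(** If [v] is the lca of [A] in [H], the lca of [A] in [G] exists and (S4) carries it to [H], so
    both agree. Conversely, (S4) turns every I-lca vertex of [G] into an lca in [H], hence into a
    vertex of [H]. *)
Lemma relevant_vertices_eq I G H :
  is_dag G -> lca_property I G ->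
  lca_relevant I H -> S0_to_S4 I (leaves G) G H ->
  vertices H = [set v in vertices G | is_lca_vertex I G v].
Proof.
move=> dagG lcaG relH [_ [dagH leafH] sHG _ s4].
apply/setP=> v; rewrite inE; apply/idP/andP=> [vH | [vG]].
  split; first exact: (subsetP sHG).
  have /existsP[A /andP[]] := relH v vH; rewrite leafH => AI /eqP lcaA.
  have [u /[dup] lcaAu /(s4 A AI)] := lcaG A AI; rewrite lcaA => -[e].
  by apply/existsP; exists A; rewrite AI lcaAu e eqxx.
by case/existsP=> A /andP[AI /eqP/(s4 A AI)/(lca_vertices dagH)].
Qed.

End Dags.

Theorem theorem3p9 (U : finType) (G : digraph U) (X : {set U}) (I : {pred nat})
    (W : {set U}) :
  dag_on X G ->
  (forall k, k \in I -> 1 <= k <= #|X|) ->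
  1 \in I ->
  lca_property I G ->
  W = [set v in vertices G | ~~ is_lca_vertex I G v] ->
  let GW := ominus_set G W in
  let GWm := remove_shortcuts GW in
  let good (H : digraph U) := lca_relevant I H /\ S0_to_S4 I X G H in
  [/\ isomorphic GWm (hasse (IC_part X I (clusters G))),
      [/\ dag_on X GW, lca_property I GW & good GW] /\
      [/\ dag_on X GWm, lca_property I GWm & good GWm],
      [/\ clusters GW = clusters GWm,
          clusters GWm = IC_part X I (clusters G) &
          ary X I (clusters GW)],
      regular GWm
    & (* [W] is the unique, hence smallest, set with the stated property *)
      (forall W' : {set U}, W' \subset vertices G ->
        good (ominus_set G W') -> good (remove_shortcuts (ominus_set G W')) ->
        W' = W) /\
      (forall W' : {set U}, W' \subset vertices G ->
        good (ominus_set G W') -> good (remove_shortcuts (ominus_set G W')) ->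
        W \subset W')].
Proof.
move=> [dagG <-] I_bound I1 lcaG defW GW GWm good.
have vertW : vertices G :\: W = [set v in vertices G | is_lca_vertex I G v].
  by apply/setP=> v; rewrite defW !inE; case: (v \in _); rewrite /= ?andbT ?negbK ?andbF.
have leafW : leaves G \subset [set v in vertices G | is_lca_vertex I G v].
  by apply/subsetP=> x xL; rewrite inE leaf_is_lca_vertex // andbT; case/setIdP: xL.
have neW : vertices G :\: W != set0.
  (* The bound at [1] says that there is a leaf, which is an I-lca vertex and hence outside [W]. *)
  have /andP[_] := I_bound _ I1; rewrite card_gt0 => /set0Pn[x xL].
  by rewrite vertW; apply/set0Pn; exists x; apply: (subsetP leafW).
have vertGW : vertices GW = [set v in vertices G | is_lca_vertex I G v].
  by rewrite ominus_set_vertices.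
have dagGW : is_dag GW by apply: ominus_set_dag.
have ordGW : induced_order G GW by apply: ominus_set_induced.
have dagGWm : is_dag GWm by apply: remove_shortcuts_dag.
have ordGWm : induced_order G GWm.
  case: ordGW => sGW gleGW; split=> // u w uG wG.
  by rewrite remove_shortcuts_gle // gleGW.
have leafGW : leaves G \subset vertices GW by rewrite vertGW.
have good_of H : is_dag H -> induced_order G H ->
    vertices H = [set v in vertices G | is_lca_vertex I G v] ->
    [/\ dag_on (leaves G) H, lca_property I H & good H] /\
    clusters H = IC_part (leaves G) I (clusters G).
  move=> dagH ordH vertH; have leafH : leaves G \subset vertices H by rewrite vertH.
  split; last exact: relevant_clusters.
  split; first by split=> //; apply: induced_leaves.
  - exact: (relevant_lca_property dagG dagH).
  - split; first exact: (relevant_lca_relevant dagG dagH).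
    exact: relevant_S0_to_S4.
have [goodGW clGW] := good_of GW dagGW ordGW vertGW.
have [goodGWm clGWm] := good_of GWm dagGWm ordGWm vertGW.
have regGWm : regular GWm.
  case: goodGWm => _ _ [relGWm _]; apply: (regular_of_relevant dagGWm relGWm).
  exact: remove_shortcuts_no_shortcut.
have uniqW (W' : {set U}) : W' \subset vertices G -> good (ominus_set G W') -> W' = W.
  move=> sW' [relW' sW4]; have := relevant_vertices_eq dagG lcaG relW' sW4.
  rewrite ominus_set_vertices // -vertW => eqD.
  have sW : W \subset vertices G by rewrite defW; apply/subsetP=> v /setIdP[].
  (* The remaining vertices determine the deleted set: complementation within [vertices G] is an
     involution on its subsets. *)
  have setDD (B : {set U}) : B \subset vertices G -> vertices G :\: (vertices G :\: B) = B.
    by move=> sB; rewrite setDDr setDv set0U; apply/setIidPr.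
  by rewrite -(setDD W') // eqD setDD.
split=> //.
(* The isomorphism is the one given by regularity, once the clusters of [GWm] are identified with
   the (I-C) part. *)
- by exists (cluster GWm); rewrite -clGWm.
- split=> //; first by rewrite clGW clGWm.
  rewrite -(induced_leaves dagG ordGW leafGW).
  by case: goodGW => _ lcaGW [relGW _]; apply: ary_clusters.
- by split=> W' sW' gW' _; rewrite (uniqW W').
Qed.
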